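(* Let $f:[0,\infty)\to\mathbb{R}$ be a smooth function having a finite limit at infinity, let $n_c>0$, let $n\ge 1$ be an integer, and let $a_k$ ($k\ge 0$) be the cosine Fourier coefficients of $\varphi$ (the function obtained from $f$ by the substitution $x=\sqrt{-n_c\log\frac{1+\cos t}{2}}$, see context). Define, for $x\ge 0$, with $p=2n$, $$f_p(x)=\sum_{\ell=0}^{n}a_\ell T_\ell\left(2e^{-x^2/n_c}-1\right)+\sum_{\ell=1}^{n-1}\left(1-\frac{\ell}{n}\right)a_{n+\ell}T_{n+\ell}\left(2e^{-x^2/n_c}-1\right),$$ where $T_m$ is the Chebyshev polynomial of order $m$. Then $f_p$ is a sum of Gaussians: for all $x\ge 0$, $$f_p(x)=\sum_{j=0}^{2n-1}w_j e^{-jx^2/n_c},$$ where $$w_0=a_0+\sum_{\ell=1}^n(-1)^\ell a_\ell+\sum_{\ell=1}^{n-1}(-1)^{n+\ell}\left(1-\frac{\ell}{n}\right)a_{n+\ell},$$ $$w_j=2^{2j}\sum_{\ell=j}^{n}(-1)^{\ell-j}\frac{\ell}{\ell+j}\binom{\ell+j}{\ell-j}a_\ell+\sum_{\ell=1}^{n-1}c_n^{j\ell}a_{n+\ell}\qquad\text{for }1\le j\le n,$$ $$w_j=\sum_{\ell=j-n}^{n-1}c_n^{j\ell}a_{n+\ell}\qquad\text{for }n<j\le 2n-1,$$ with $$c_n^{j\ell}=(-1)^{n+\ell-j}\left(1-\frac{\ell}{n}\right)\frac{n+\ell}{n+\ell+j}\binom{n+\ell+j}{n+\ell-j}2^{2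j}.$$
   Context: Here $\varphi:[0,\pi]\to\mathbb{R}$ is defined by $\varphi(t)=f(x)$ with $x=\sqrt{-n_c\log\left(\frac{1+\cos t}{2}\right)}$ for $t\in[0,\pi)$ (a one-to-one map onto $[0,\infty)$, with inverse $t=\arccos(2e^{-x^2/n_c}-1)$) and $\varphi(\pi)=f(\infty):=\lim_{x\to\infty}f(x)$. The coefficients are $$a_0=\frac1\pi\int_0^\pi\varphi(t)\,dt,\qquad a_k=\frac2\pi\int_0^\pi\varphi(t)\cos(kt)\,dt\quad(k\ge1).$$ $T_m$ denotes the Chebyshev polynomial of the first kind, $T_m(y)=\cos(m\arccos y)$ for $y\in[-1,1]$. Empty sums are zero. *)

(* Defs.v *)
From Stdlib Require Import Reals Arith.
From Coquelicot Require Import Coquelicot.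
Open Scope R_scope.

(* Derivatives of all orders on [0, oo), one-sided at 0: the values of f on
   the negative half-line play no role. *)
Definition smooth_on_nonneg (f : R -> R) : Prop :=
  exists g : nat -> R -> R,
    (forall x, 0 <= x -> g 0%nat x = f x) /\
    (forall k x, 0 <= x -> D_in (g k) (g (S k)) (fun y => 0 <= y) x).

(* Only used for t in [0, PI]. *)
Definition phi (f : R -> R) (nc t : R) : R :=
  if Rlt_dec t PI then f (sqrt (- nc * ln ((1 + cos t) / 2)))
  else real (Lim f p_infty).

Definition a (f : R -> R) (nc : R) (k : nat) : R :=
  match k with
  | O => 1 / PI * RInt (phi f nc) 0 PI
  | S _ => 2 / PI * RInt (fun t => phi f nc t * cos (INR k * t)) 0 PI
  end.

(* The Chebyshev polynomial of order m on [-1, 1]; its argument is always of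
   the form 2 * exp (- x^2 / nc) - 1, hence in that interval. *)
Definition T (m : nat) (y : R) : R := cos (INR m * acos y).

(* [sum_n_m u i k] is the sum of u i, ..., u k, and it is 0 when k < i. *)
Definition fp (f : R -> R) (nc : R) (n : nat) (x : R) : R :=
  sum_n_m (fun l => a f nc l * T l (2 * exp (- x ^ 2 / nc) - 1)) 0 n
  + sum_n_m (fun l => (1 - INR l / INR n) * a f nc (n + l)
                      * T (n + l) (2 * exp (- x ^ 2 / nc) - 1)) 1 (n - 1).

(* Used for j <= n + l only, so that no natural subtraction is truncated. *)
Definition c (n j l : nat) : R :=
  (-1) ^ (n + l - j) * (1 - INR l / INR n)
  * (INR (n + l) / INR (n + l + j)) * Binomial.C (n + l + j) (n + l - j)
  * 2 ^ (2 * j).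

Definition w (f : R -> R) (nc : R) (n j : nat) : R :=
  if (j =? 0)%nat then
    a f nc 0
    + sum_n_m (fun l => (-1) ^ l * a f nc l) 1 n
    + sum_n_m (fun l => (-1) ^ (n + l) * (1 - INR l / INR n)
                        * a f nc (n + l)) 1 (n - 1)
  else if (j <=? n)%nat then
    2 ^ (2 * j)
    * sum_n_m (fun l => (-1) ^ (l - j) * (INR l / INR (l + j))
                        * Binomial.C (l + j) (l - j) * a f nc l) j n
    + sum_n_m (fun l => c n j l * a f nc (n + l)) 1 (n - 1)
  else
    sum_n_m (fun l => c n j l * a f nc (n + l)) (j - n) (n - 1).

(* Main.v *)
Require Import Defs.
From Stdlib Require Import Reals Factorial Lra Lia.
From Coquelicot Require Import Coquelicot.
Open Scope R_scope.

(** The shifted Chebyshev polynomials [T m (2 z - 1)] have explicit coefficients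
    in [z], obtained by checking that these satisfy the recurrence
    [T (m+2) (2z-1) = (4z-2) T (m+1) (2z-1) - T m (2z-1)].  Substituting
    [z = exp (- x^2 / nc)], so that [z^j] is the [j]-th Gaussian, and exchanging
    the two sums gives the weights. *)

(* The case [m = 0] is separate since [INR m / INR (m + j)] is 0 / 0 there.
   The guard is needed since [Binomial.C (m + j) (m - j)] is not 0 for
   [m < j], as [m - j] is truncated. *)
Definition shifted_cheb_coef (m j : nat) : R :=
  if (j <=? m)%nat then
    if (m =? 0)%nat then 1
    else (-1) ^ (m - j) * (INR m / INR (m + j))
         * Binomial.C (m + j) (m - j) * 2 ^ (2 * j)
  else 0.

(** * Closed forms and recurrence of the coefficients *)

Lemma shifted_cheb_coef_pos (m j : nat) : (0 < m)%nat -> (j <= m)%nat ->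
  shifted_cheb_coef m j =
  (-1) ^ (m - j) * (INR m / INR (m + j))
  * Binomial.C (m + j) (m - j) * 2 ^ (2 * j).
Proof.
intros Hm Hj; unfold shifted_cheb_coef.
rewrite (proj2 (Nat.leb_le j m) Hj), (proj2 (Nat.eqb_neq m 0)) by lia.
reflexivity.
Qed.

Lemma shifted_cheb_coef_gt (m j : nat) :
  (m < j)%nat -> shifted_cheb_coef m j = 0.
Proof.
intros H; unfold shifted_cheb_coef.
now rewrite (proj2 (Nat.leb_gt j m) H).
Qed.

(** Writing $m = j + d + 1$ removes the truncated subtraction, and the denominator $m + j$ cancels
    against $(m+j)!$. Only factorials and powers remain, in a form suited to [field]. *)
Lemma shifted_cheb_coef_fact (j d : nat) :
  shifted_cheb_coef (j + S d) j =
  (-1) ^ S d * 4 ^ j * INR (j + S d) * INR (fact (2 * j + d))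
  / (INR (fact (S d)) * INR (fact (2 * j))).
Proof.
rewrite shifted_cheb_coef_pos by lia; unfold Binomial.C.
replace (j + S d - j)%nat with (S d) by lia.
replace (j + S d + j)%nat with (S (2 * j + d)) by lia.
replace (S (2 * j + d) - S d)%nat with (2 * j)%nat by lia.
rewrite pow_mult; replace (2 ^ 2) with 4 by ring.
rewrite (fact_simpl (2 * j + d)), mult_INR.
field; repeat split; try apply INR_fact_neq_0; now apply not_0_INR.
Qed.

Lemma shifted_cheb_coef_diag (j : nat) :
  shifted_cheb_coef (S j) (S j) = 4 ^ S j / 2.
Proof.
rewrite shifted_cheb_coef_pos by lia; unfold Binomial.C.
rewrite Nat.sub_diag, Nat.sub_0_r.
rewrite pow_mult; replace (2 ^ 2) with 4 by ring.
rewrite plus_INR; change (INR (fact 0)) with 1; rewrite pow_O.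
pose proof (lt_0_INR (S j) (Nat.lt_0_succ j)).
field; split; [apply INR_fact_neq_0 | lra].
Qed.

(** This is the value at $z = 0$, namely $T_m(-1)$. *)
Lemma shifted_cheb_coef_0 (m : nat) : shifted_cheb_coef m 0 = (-1) ^ m.
Proof.
destruct m as [|d]; [reflexivity|].
rewrite <- (Nat.add_0_l (S d)) at 1; rewrite shifted_cheb_coef_fact.
rewrite fact_simpl, mult_INR.
change (0 + S d)%nat with (S d); change (2 * 0 + d)%nat with d.
change (INR (fact (2 * 0))) with 1.
simpl (4 ^ 0); field.
split; [apply INR_fact_neq_0 | now apply not_0_INR].
Qed.

(** Comparison of the coefficients of $z^{i+1}$ in the three-term recurrence. The cases record which
    of the four entries lie below, on or above the diagonal, as each has its own closed form. *)
Lemma shifted_cheb_coef_rec (m i : nat) :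
  shifted_cheb_coef (S (S m)) (S i) =
  4 * shifted_cheb_coef (S m) i - 2 * shifted_cheb_coef (S m) (S i)
  - shifted_cheb_coef m (S i).
Proof.
destruct (Nat.lt_trichotomy i (S m)) as [Hi | [-> | Hi]].
- destruct (Nat.lt_trichotomy (S i) m) as [Hm | [<- | Hm]].
  + assert (exists d, m = (S i + S d)%nat) as [d ->]
      by (exists (m - i - 2)%nat; lia).
    replace (S (S (S i + S d))) with (S i + S (S (S d)))%nat by lia.
    rewrite (shifted_cheb_coef_fact (S i) (S (S d))).
    replace (S (S i + S d)) with (i + S (S (S d)))%nat by lia.
    rewrite (shifted_cheb_coef_fact i).
    replace (i + S (S (S d)))%nat with (S i + S (S d))%nat by lia.
    rewrite !(shifted_cheb_coef_fact (S i)).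
    (* Every factorial is reduced to those of [2 * i + d], [2 * i] and [d], which leaves an identity
       of rational functions in [i] and [d]. *)
    replace (2 * S i + S (S d))%nat with (S (S (S (S (2 * i + d))))) by lia.
    replace (2 * i + S (S d))%nat with (S (S (2 * i + d))) by lia.
    replace (2 * S i + S d)%nat with (S (S (S (2 * i + d)))) by lia.
    replace (2 * S i + d)%nat with (S (S (2 * i + d))) by lia.
    replace (2 * S i)%nat with (S (S (2 * i))) by lia.
    rewrite !fact_simpl, !mult_INR, !plus_INR, !S_INR, !plus_INR, !mult_INR.
    change (INR 2) with 2; rewrite <- !tech_pow_Rmult.
    pose proof (pos_INR i); pose proof (pos_INR d).
    field; repeat split; try apply INR_fact_neq_0; lra.
  + replace (S (S (S i))) with (S i + 2)%nat by lia.
    rewrite (shifted_cheb_coef_fact (S i) 1).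
    replace (S (S i)) with (i + 2)%nat by lia.
    rewrite (shifted_cheb_coef_fact i 1).
    replace (i + 2)%nat with (S i + 1)%nat by lia.
    rewrite (shifted_cheb_coef_fact (S i) 0), shifted_cheb_coef_diag.
    rewrite Nat.add_0_r.
    replace (2 * S i + 1)%nat with (S (S (S (2 * i)))) by lia.
    replace (2 * i + 1)%nat with (S (2 * i)) by lia.
    replace (2 * S i)%nat with (S (S (2 * i))) by lia.
    rewrite !fact_simpl, !mult_INR, !plus_INR, !S_INR, !mult_INR.
    change (INR 2) with 2; change (INR 0) with 0; change (INR (fact 0)) with 1.
    rewrite <- !tech_pow_Rmult, !pow_O.
    pose proof (pos_INR i).
    field; repeat split; try apply INR_fact_neq_0; lra.
  + replace i with m by lia.
    rewrite shifted_cheb_coef_diag, (shifted_cheb_coef_gt m) by lia.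
    replace (S (S m)) with (S m + 1)%nat by lia.
    rewrite (shifted_cheb_coef_fact (S m) 0).
    replace (shifted_cheb_coef (S m) m) with (shifted_cheb_coef (m + 1) m)
      by now rewrite Nat.add_1_r.
    rewrite (shifted_cheb_coef_fact m 0).
    rewrite !Nat.add_0_r, !plus_INR, S_INR.
    change (INR 1) with 1; change (INR (fact 1)) with 1.
    rewrite <- !tech_pow_Rmult, !pow_O.
    field; repeat split; apply INR_fact_neq_0.
(* Only the leading coefficients survive: $4^{m+2}/2 = 4 \cdot 4^{m+1}/2$. *)
- rewrite !shifted_cheb_coef_diag, !shifted_cheb_coef_gt by lia.
  rewrite <- !tech_pow_Rmult; field.
- rewrite !shifted_cheb_coef_gt by lia; ring.
Qed.

(** * Finite sums *)

Lemma sum_n_m_exchange {G : AbelianMonoid} (u : nat -> nat -> G)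
  (p q r s : nat) :
  sum_n_m (fun i => sum_n_m (u i) r s) p q =
  sum_n_m (fun j => sum_n_m (fun i => u i j) p q) r s.
Proof.
induction s as [|s IHs].
- destruct r as [|r].
  + rewrite sum_n_n; apply sum_n_m_ext; intros i; apply sum_n_n.
  + rewrite (sum_n_m_zero _ (S r)) by lia.
    rewrite (sum_n_m_ext _ (fun _ => zero)), sum_n_m_const_zero; [reflexivity|].
    intros i; apply sum_n_m_zero; lia.
- destruct (Nat.le_gt_cases r (S s)) as [H|H].
  + rewrite sum_n_Sm, <- IHs, <- sum_n_m_plus by exact H.
    apply sum_n_m_ext; intros i; now apply sum_n_Sm.
  + rewrite (sum_n_m_zero _ r) by exact H.
    rewrite (sum_n_m_ext _ (fun _ => zero)), sum_n_m_const_zero; [reflexivity|].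
    intros i; now apply sum_n_m_zero.
Qed.

Lemma sum_n_m_drop_zeros {G : AbelianMonoid} (u : nat -> G) (p k q : nat) :
  (p <= k <= S q)%nat ->
  (forall i, (p <= i < k)%nat -> u i = zero) ->
  sum_n_m u p q = sum_n_m u k q.
Proof.
intros Hk Hu; destruct k as [|k]; [now replace p with 0%nat by lia|].
destruct (Nat.eq_dec p (S k)) as [-> | Hp]; [reflexivity|].
rewrite (sum_n_m_Chasles u p k q) by lia.
rewrite (sum_n_m_ext_loc u (fun _ => zero) p k), sum_n_m_const_zero.
- apply plus_zero_l.
- intros i Hi; apply Hu; lia.
Qed.

(** This lemma and the next two specialize generic ones to [R], so that rewriting and [ring] meet
    real operations instead of those of an algebraic structure. *)
Lemma Rmult_sum_n_m (b : R) (u : nat -> R) (p q : nat) :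
  b * sum_n_m u p q = sum_n_m (fun i => b * u i) p q.
Proof. symmetry; exact (sum_n_m_mult_l (K := R_Ring) b u p q). Qed.

Lemma Rplus_sum_n_m (u v : nat -> R) (p q : nat) :
  sum_n_m u p q + sum_n_m v p q = sum_n_m (fun i => u i + v i) p q.
Proof. symmetry; exact (sum_n_m_plus u v p q). Qed.

Lemma Rsum_n_m_ext (u v : nat -> R) (p q : nat) :
  (forall i, (p <= i <= q)%nat -> u i = v i) ->
  sum_n_m u p q = sum_n_m v p q.
Proof. apply sum_n_m_ext_loc. Qed.

(** * Expansion of the shifted Chebyshev polynomials *)

Lemma T_0 (y : R) : T 0 y = 1.
Proof. unfold T; simpl INR; now rewrite Rmult_0_l, cos_0. Qed.

Lemma T_1 (y : R) : -1 <= y <= 1 -> T 1 y = y.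
Proof.
intros Hy; unfold T; simpl INR; rewrite Rmult_1_l; now apply cos_acos.
Qed.

(** With $\theta = \arccos y$, this is the addition formula for $\cos((m+1)\theta \pm \theta)$. *)
Lemma T_rec (m : nat) (y : R) : -1 <= y <= 1 ->
  T (S (S m)) y = 2 * y * T (S m) y - T m y.
Proof.
intros Hy; unfold T; rewrite <- (cos_acos y Hy) at 2.
replace (INR (S (S m)) * acos y) with (INR (S m) * acos y + acos y)
  by (rewrite (S_INR (S m)); ring).
replace (INR m * acos y) with (INR (S m) * acos y - acos y)
  by (rewrite S_INR; ring).
rewrite cos_plus, cos_minus; ring.
Qed.

(** The constant terms are split off, and the others are compared by [shifted_cheb_coef_rec]. The
    bound on [N] ensures that multiplication by $z$ pushes no nonzero term out of range. *)
Lemma shifted_cheb_poly_rec (m N : nat) (z : R) : (S (S m) <= N)%nat ->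
  sum_n_m (fun j => shifted_cheb_coef (S (S m)) j * z ^ j) 0 N =
  2 * (2 * z - 1) * sum_n_m (fun j => shifted_cheb_coef (S m) j * z ^ j) 0 N
  - sum_n_m (fun j => shifted_cheb_coef m j * z ^ j) 0 N.
Proof.
intros HN; destruct N as [|N]; [lia|].
set (P k := sum_n_m (fun j => shifted_cheb_coef k j * z ^ j) 0 (S N)).
set (Q k := sum_n_m (fun j => shifted_cheb_coef k (S j) * z ^ S j) 0 N).
assert (HP : forall k, P k = (-1) ^ k + Q k).
{ intros k; unfold P, Q; rewrite sum_Sn_m, <- sum_n_m_S by lia.
  rewrite shifted_cheb_coef_0, pow_O, Rmult_1_r; reflexivity. }
assert (Htop : P (S m) =
  sum_n_m (fun j => shifted_cheb_coef (S m) j * z ^ j) 0 N).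
{ unfold P; rewrite sum_n_Sm, shifted_cheb_coef_gt, Rmult_0_l by lia.
  exact (Rplus_0_r _). }
assert (HQ : Q (S (S m)) = 4 * z * P (S m) + (-2) * Q (S m) + (-1) * Q m).
{ rewrite Htop; unfold Q.
  rewrite !Rmult_sum_n_m, !Rplus_sum_n_m.
  apply Rsum_n_m_ext; intros i _; rewrite shifted_cheb_coef_rec; simpl; ring. }
(* The constant terms match since $(-1)^{m+2} = -2(-1)^{m+1} - (-1)^m$. *)
change (P (S (S m)) = 2 * (2 * z - 1) * P (S m) - P m).
pose proof (HP (S (S m))) as H2; pose proof (HP (S m)) as H1.
pose proof (HP m) as H0; simpl in H2, H1; nra.
Qed.

(** The upper bound [N] does not depend on [m], so that sums over [m] and [j] can later be
    exchanged. *)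
Lemma T_shifted (z : R) (N : nat) (m : nat) : 0 <= z <= 1 -> (m <= N)%nat ->
  T m (2 * z - 1) = sum_n_m (fun j => shifted_cheb_coef m j * z ^ j) 0 N.
Proof.
intros Hz.
assert (Htail : forall k M, (k <= M)%nat ->
  sum_n_m (fun j => shifted_cheb_coef k j * z ^ j) 0 M =
  sum_n_m (fun j => shifted_cheb_coef k j * z ^ j) 0 k).
{ intros k M HM; induction HM as [|M HM IH]; [reflexivity|].
  rewrite sum_n_Sm, IH, shifted_cheb_coef_gt, Rmult_0_l by lia.
  exact (Rplus_0_r _). }
(* Two consecutive orders are carried along, as the recurrence has two steps. *)
assert (H : forall k,
  ((k <= N)%nat -> T k (2 * z - 1) =
    sum_n_m (fun j => shifted_cheb_coef k j * z ^ j) 0 N) /\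
  ((S k <= N)%nat -> T (S k) (2 * z - 1) =
    sum_n_m (fun j => shifted_cheb_coef (S k) j * z ^ j) 0 N)).
{ induction k as [|k [IH0 IH1]].
  - split; intros HN; rewrite Htail by exact HN.
    + rewrite T_0, sum_n_n, shifted_cheb_coef_0; simpl; ring.
    + rewrite T_1 by lra.
      rewrite sum_n_Sm, sum_n_n, shifted_cheb_coef_0, shifted_cheb_coef_diag
        by lia.
      unfold plus; simpl; field.
  - split; [exact IH1 | intros HN].
    rewrite T_rec, IH1, IH0 by (lra || lia).
    symmetry; now apply shifted_cheb_poly_rec. }
exact (proj1 (H m)).
Qed.

(** * Identification of the weights *)

Lemma c_shifted_cheb_coef (n j l : nat) : (0 < n)%nat -> (j <= n + l)%nat ->
  c n j l = (1 - INR l / INR n) * shifted_cheb_coef (n + l) j.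
Proof.
intros Hn Hj; rewrite shifted_cheb_coef_pos by lia; unfold c; ring.
Qed.

(** The three cases of [w] are one formula: the sums starting at [j] or [j - n] omit exactly the
    terms in which the order is below [j], where the coefficient vanishes. *)
Lemma w_shifted_cheb_coef (f : R -> R) (nc : R) (n j : nat) : (0 < n)%nat ->
  (j <= 2 * n - 1)%nat ->
  w f nc n j =
  sum_n_m (fun l => a f nc l * shifted_cheb_coef l j) 0 n
  + sum_n_m (fun l => (1 - INR l / INR n) * a f nc (n + l)
                      * shifted_cheb_coef (n + l) j) 1 (n - 1).
Proof.
intros Hn Hj; unfold w.
destruct (Nat.eqb_spec j 0) as [-> | Hj0].
- rewrite (sum_Sn_m _ 0 n) by lia.
  rewrite shifted_cheb_coef_0, pow_O, Rmult_1_r.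
  unfold plus; simpl; f_equal; [f_equal|];
    apply Rsum_n_m_ext; intros l _; rewrite shifted_cheb_coef_0; ring.
- destruct (Nat.leb_spec j n) as [Hjn | Hjn]; f_equal.
  + rewrite (sum_n_m_drop_zeros _ 0 j n); [|lia|].
    * rewrite Rmult_sum_n_m.
      apply Rsum_n_m_ext; intros l Hl.
      rewrite shifted_cheb_coef_pos by lia; ring.
    * intros l Hl; rewrite shifted_cheb_coef_gt by lia; apply Rmult_0_r.
  + apply Rsum_n_m_ext; intros l Hl.
    rewrite c_shifted_cheb_coef by lia; ring.
  (* For [j > n] the whole first sum vanishes, all its orders being at most [n]. *)
  + rewrite (sum_n_m_ext_loc _ (fun _ => zero) 0 n), sum_n_m_const_zero.
    * rewrite (sum_n_m_drop_zeros _ 1 (j - n) (n - 1)); [|lia|].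
      -- unfold zero; simpl; rewrite Rplus_0_l.
         apply Rsum_n_m_ext; intros l Hl.
         rewrite c_shifted_cheb_coef by lia; ring.
      -- intros l Hl; rewrite shifted_cheb_coef_gt by lia; apply Rmult_0_r.
    * intros l Hl; rewrite shifted_cheb_coef_gt by lia; apply Rmult_0_r.
Qed.

(** The index map [g] covers both sums of [fp], with orders [l] and [n + l]. *)
Lemma sum_T_shifted (b : nat -> R) (g : nat -> nat) (z : R) (p q N : nat) :
  0 <= z <= 1 ->
  (forall l, (p <= l <= q)%nat -> (g l <= N)%nat) ->
  sum_n_m (fun l => b l * T (g l) (2 * z - 1)) p q =
  sum_n_m (fun j => sum_n_m (fun l => b l * shifted_cheb_coef (g l) j) p q
                    * z ^ j) 0 N.
Proof.
intros Hz Hg.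
rewrite (sum_n_m_ext_loc _
  (fun l => sum_n_m (fun j => b l * shifted_cheb_coef (g l) j * z ^ j) 0 N)).
- rewrite sum_n_m_exchange; apply sum_n_m_ext; intros j.
  exact (sum_n_m_mult_r (K := R_Ring) (z ^ j) _ p q).
- intros l Hl; rewrite (T_shifted z N) by auto.
  rewrite Rmult_sum_n_m; apply Rsum_n_m_ext; intros j _; ring.
Qed.

Lemma exp_mult_INR (j : nat) (u : R) : exp (INR j * u) = exp u ^ j.
Proof.
induction j as [|j IHj].
- simpl; now rewrite Rmult_0_l, exp_0.
- rewrite S_INR, Rmult_plus_distr_r, Rmult_1_l, exp_plus, IHj; simpl; ring.
Qed.

Theorem theorem1 (f : R -> R) (nc : R) (n : nat)
  (f_smooth : smooth_on_nonneg f)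
  (f_lim : ex_finite_lim f p_infty)
  (nc_pos : 0 < nc)
  (n_ge1 : (1 <= n)%nat) :
  forall x : R, 0 <= x ->
    fp f nc n x =
    sum_n_m (fun j => w f nc n j * exp (- INR j * x ^ 2 / nc)) 0 (2 * n - 1).
Proof.
intros x _; unfold fp.
set (z := exp (- x ^ 2 / nc)).
assert (Hz : 0 <= z <= 1).
{ split; [apply Rlt_le, exp_pos|].
  rewrite <- exp_0; unfold z.
  assert (Hx : 0 <= x ^ 2 / nc)
    by (apply Rdiv_le_0_compat; [apply pow2_ge_0 | exact nc_pos]).
  replace (- x ^ 2 / nc) with (- (x ^ 2 / nc)) by (field; lra).
  (* [exp_increasing] is strict, so a zero exponent is treated apart. *)
  destruct Hx as [Hx | <-]; [|rewrite Ropp_0; lra].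
  apply Rlt_le, exp_increasing; lra. }
(* The common bound [2 * n - 1] is the largest order $n + (n-1)$, and is at least $n$ because $n \ge
   1$. *)
rewrite (sum_T_shifted (a f nc) (fun l => l) z 0 n (2 * n - 1) Hz)
  by (intros l Hl; lia).
rewrite (sum_T_shifted (fun l => (1 - INR l / INR n) * a f nc (n + l))
  (fun l => (n + l)%nat) z 1 (n - 1) (2 * n - 1) Hz) by (intros l Hl; lia).
rewrite Rplus_sum_n_m; apply Rsum_n_m_ext; intros j Hj.
rewrite w_shifted_cheb_coef by lia.
replace (- INR j * x ^ 2 / nc) with (INR j * (- x ^ 2 / nc)) by (field; lra).
rewrite exp_mult_INR; fold z; ring.
Qed.
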